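(* Let $z,\sigma,\tau\in\mathbb{R}$ and $A(z)=I-z\,D_0+\frac{z^2}{2}\,\Delta+\sigma\,D_0\Delta+\tau\,\Delta^2$. Take $h_0=1/2$ in the inner product $(\cdot,\cdot)_H$ and consider the set of second order extrapolation conditions $\Delta\Phi_0=\Delta^2\Phi_0=0$ (which define the ghost values $\Phi_1,\Phi_2$). Then the boundary contribution $E:=\frac12T_{-1}+\frac12T_0+\frac12S_0$ is given by $$E=\begin{pmatrix}\Phi_0\\ D\Phi_0\\ D^2\Phi_0\end{pmatrix}^T B\begin{pmatrix}\Phi_0\\ D\Phi_0\\ D^2\Phi_0\end{pmatrix},$$ $$B:=\begin{pmatrix}-z&\frac{z^2}{2}&-\tau\\ \frac{z^2}{2}&-\frac{z^3}{2}-\sigma&z\tau\\ -\tau&z\tau&\frac{2\tau}{3}+\sigma\tau+\frac{5z\sigma}{12}-\frac{z^2\tau}{2}+\frac{\sigma^2}{2}-\frac{z^2(1-z^2)}{12}\end{pmatrix}.$$ In particular, the scheme is semi-bounded (i.e. $B$ is negative semi-definite) for all $z\in(0,1)$ at least in the following two special cases: (i) $\sigma=z(1-z^2)/6$ and $\tau=-\sigma/2$; (ii) $\sigma=z(1-z^2)/6$ and $\tau=-z^2(1-z^2)/24$.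
   Context: Difference operators: $D\Phi_j:=\Phi_j-\Phi_{j-1}$, $D_0\Phi_j:=\frac12(\Phi_{j+1}-\Phi_{j-1})$, $\Delta\Phi_j:=\Phi_{j-1}-2\Phi_j+\Phi_{j+1}$, and their compositions $D^2$, $D\Delta$, $D_0\Delta$, $\Delta^2$; $I$ is the identity. Sequences are real valued. Inner product (with $h_0=\frac12$): $(\boldsymbol{\Phi},\boldsymbol{\Psi})_H:=\sum_{j\le -1}\Phi_j\Psi_j+h_0\Phi_0\Psi_0$ for sequences indexed by $j\le0$. With $a_1:=\frac{z^2(z^2-1)}{4}+2z\sigma+2\tau$, $a_2:=-\frac{z\sigma}{4}+\frac{\sigma^2}{2}-\frac{z^2\tau}{2}$, $a_3:=-\frac{\sigma^2}{4}+\tau^2$, set $$T_j:=X_j^TQX_j,\quad X_j:=\begin{pmatrix}\Phi_j\\ D\Phi_{j+1}\\ \Delta\Phi_j\\ D\Delta\Phi_{j+1}\end{pmatrix},$$ $$Q:=\begin{pmatrix}-z&-\frac{z(1-z)}{2}&\sigma&\frac{\sigma}{2}+\tau\\ -\frac{z(1-z)}{2}&\frac{z^2(1-z)}{2}-\sigma&\frac{\sigma}{2}-z\sigma-\tau&-z\left(\frac{\sigma}{2}+\tau\right)\\ \sigma&\frac{\sigma}{2}-z\sigma-\tau&\frac{z^2\sigma}{2}+z\tau&\frac{z(1+z)}{2}\left(\frac{\sigma}{2}+\tau\right)-\frac{a_1}{3}\\ \frac{\sigma}{2}+\tau&-z\left(\frac{\sigma}{2}+\tau\right)&\frac{z(1+z)}{2}\left(\frac{\sigma}{2}+\tau\right)-\frac{a_1}{3}&\frac{z\sigma}{4}+\frac{z^2\tau}{2}+\sigma\tau-\frac{a_1}{3}\end{pmatrix},$$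 $$S_j:=Y_j^TMY_j,\quad Y_j:=\begin{pmatrix}\Delta\Phi_{j-1}\\ \Delta\Phi_j\\ \Delta\Phi_{j+1}\end{pmatrix},\quad M:=\frac{a_1}{3}\begin{pmatrix}1&0&0\\0&1&0\\0&0&1\end{pmatrix}+a_2\begin{pmatrix}1&-1&0\\-1&2&-1\\0&-1&1\end{pmatrix}+a_3\begin{pmatrix}1&-2&1\\-2&4&-2\\1&-2&1\end{pmatrix}.$$ Semi-boundedness: together with extrapolation conditions defining the ghost values $\Phi_1,\Phi_2$ from $(\Phi_j)_{j\le 0}$, $A(z)$ is called semi-bounded with respect to $(\cdot,\cdot)_H$ if, for the given $z\ge0$: (1) the scheme is contractive, i.e. for every real sequence $(\Phi_j)_{j\in\mathbb{Z}}$, with $\Psi_j=A(z)\Phi_j$, one has $\Psi_j^2=\Phi_j^2+T_j-T_{j-1}+S_j$ and $S_j\le0$ for all $j$; and (2) for every sequence $(\Phi_j)_{j\le0}$ extended by the extrapolation conditions, $E:=(1-h_0)T_{-1}+h_0T_0+h_0S_0\le0$. *)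

(* Defs.v *)
From HB Require Import structures.
From mathcomp Require Import all_boot all_order all_algebra.
From mathcomp Require Import reals.

Set Implicit Arguments.
Unset Strict Implicit.
Unset Printing Implicit Defensive.

Import Order.TTheory GRing.Theory Num.Theory.

Local Open Scope ring_scope.

Section Matrices.
Variable R : realType.

(* Missing entries are 0 and extra entries are dropped. *)
Definition mx_of_rows (m n : nat) (rows : seq (seq R)) : 'M[R]_(m, n) :=
  \matrix_(i < m, j < n) (nth [::] rows i)`_j.

Definition cv_of_seq (n : nat) (s : seq R) : 'cV[R]_n := \col_(i < n) s`_i.

Definition quad_form (n : nat) (M : 'M[R]_n) (v : 'cV[R]_n) : R :=
  (v^T *m M *m v) 0 0.

Definition neg_semidefinite (n : nat) (M : 'M[R]_n) : Prop :=
  M^T = M /\ forall v : 'cV[R]_n, quad_form M v <= 0.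

End Matrices.

Section Scheme.
Variable R : realType.
Implicit Types (Phi : int -> R) (j : int) (z sigma tau : R).

Definition Dm Phi : int -> R := fun j => Phi j - Phi (j - 1).

Definition D0 Phi : int -> R := fun j => (Phi (j + 1) - Phi (j - 1)) / 2.

Definition Delta Phi : int -> R :=
  fun j => Phi (j - 1) - 2 * Phi j + Phi (j + 1).

Definition A_op z sigma tau Phi : int -> R := fun j =>
  Phi j - z * D0 Phi j + z ^+ 2 / 2 * Delta Phi j
  + sigma * D0 (Delta Phi) j + tau * Delta (Delta Phi) j.

Definition a1 z sigma tau : R :=
  z ^+ 2 * (z ^+ 2 - 1) / 4 + 2 * z * sigma + 2 * tau.

Definition a2 z sigma tau : R :=
  - (z * sigma / 4) + sigma ^+ 2 / 2 - z ^+ 2 * tau / 2.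

Definition a3 (sigma tau : R) : R := - (sigma ^+ 2 / 4) + tau ^+ 2.

Definition Qmx z sigma tau : 'M[R]_4 :=
  let h := sigma / 2 + tau in
  let q34 := z * (1 + z) / 2 * h - a1 z sigma tau / 3 in
  mx_of_rows 4 4
    [:: [:: - z; - (z * (1 - z) / 2); sigma; h];
        [:: - (z * (1 - z) / 2); z ^+ 2 * (1 - z) / 2 - sigma;
            sigma / 2 - z * sigma - tau; - z * h];
        [:: sigma; sigma / 2 - z * sigma - tau;
            z ^+ 2 * sigma / 2 + z * tau; q34];
        [:: h; - z * h; q34;
            z * sigma / 4 + z ^+ 2 * tau / 2 + sigma * tau
            - a1 z sigma tau / 3]].

Definition Mmx z sigma tau : 'M[R]_3 :=
  (a1 z sigma tau / 3) *: 1%:M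
  + a2 z sigma tau *:
      mx_of_rows 3 3 [:: [:: 1; -1; 0]; [:: -1; 2; -1]; [:: 0; -1; 1]]
  + a3 sigma tau *:
      mx_of_rows 3 3 [:: [:: 1; -2; 1]; [:: -2; 4; -2]; [:: 1; -2; 1]].

Definition Xvec Phi j : 'cV[R]_4 :=
  cv_of_seq 4 [:: Phi j; Dm Phi (j + 1); Delta Phi j; Dm (Delta Phi) (j + 1)].

Definition Yvec Phi j : 'cV[R]_3 :=
  cv_of_seq 3 [:: Delta Phi (j - 1); Delta Phi j; Delta Phi (j + 1)].

Definition Tflux z sigma tau Phi j : R :=
  quad_form (Qmx z sigma tau) (Xvec Phi j).

Definition Sterm z sigma tau Phi j : R :=
  quad_form (Mmx z sigma tau) (Yvec Phi j).

(* The weight [h0] is that of the index 0 in the inner product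
   (Phi, Psi)_H = \sum_(j <= -1) Phi_j Psi_j + h0 Phi_0 Psi_0;
   it is the only datum of (., .)_H on which semi-boundedness depends. *)
Definition boundary_contribution (h0 : R) z sigma tau Phi : R :=
  (1 - h0) * Tflux z sigma tau Phi (-1) + h0 * Tflux z sigma tau Phi 0
  + h0 * Sterm z sigma tau Phi 0.

Definition contractive z sigma tau : Prop :=
  forall Phi j,
    A_op z sigma tau Phi j ^+ 2
      = Phi j ^+ 2 + Tflux z sigma tau Phi j - Tflux z sigma tau Phi (j - 1)
        + Sterm z sigma tau Phi j
    /\ Sterm z sigma tau Phi j <= 0.

(* A sequence on j <= 0 with its ghost values Phi_1, Phi_2 is represented by
   Phi : int -> R; the boundary contribution only reads indices -2 .. 2.
   Extrapolation conditions are a predicate on such Phi. *)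
Definition with_ghosts Phi (g : R * R) : int -> R :=
  fun j => if j == 1 then g.1 else if j == 2 then g.2 else Phi j.

Definition defines_ghost_values (extrap : (int -> R) -> Prop) : Prop :=
  forall Phi, exists! g : R * R, extrap (with_ghosts Phi g).

Definition semi_bounded (h0 : R) (extrap : (int -> R) -> Prop) z sigma tau
    : Prop :=
  contractive z sigma tau
  /\ forall Phi, extrap Phi -> boundary_contribution h0 z sigma tau Phi <= 0.

Definition extrapolation2 Phi : Prop :=
  Delta Phi 0 = 0 /\ Delta (Delta Phi) 0 = 0.

Definition Bmx z sigma tau : 'M[R]_3 :=
  mx_of_rows 3 3
    [:: [:: - z; z ^+ 2 / 2; - tau];
        [:: z ^+ 2 / 2; - (z ^+ 3 / 2) - sigma; z * tau];
        [:: - tau; z * tau;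
            2 * tau / 3 + sigma * tau + 5 * z * sigma / 12
            - z ^+ 2 * tau / 2 + sigma ^+ 2 / 2
            - z ^+ 2 * (1 - z ^+ 2) / 12]].

Definition Zvec Phi : 'cV[R]_3 :=
  cv_of_seq 3 [:: Phi 0; Dm Phi 0; Dm (Dm Phi) 0].

End Scheme.

(* Main.v *)
Require Import Defs.
From HB Require Import structures.
From mathcomp Require Import all_boot all_order all_algebra.
From mathcomp Require Import reals.
From mathcomp Require Import ring lra.

Set Implicit Arguments.
Unset Strict Implicit.
Unset Printing Implicit Defensive.

Import Order.TTheory GRing.Theory Num.Theory.

Local Open Scope ring_scope.

(** The cell energy identity and the formula for [E] are polynomial identities
    once the quadratic forms of [Q], [M] and [B] are expanded; the ghost
    conditions determine [Phi 1] and [Phi 2] successively as linear functions of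
    [Phi 0], [Phi (-1)], [Phi (-2)], hence of the coordinates of [B].

    Semi-boundedness then needs two signs.  By its definition, [S_j] is a
    combination of sums of squares with coefficients [a1 / 3], [a2], [a3], so
    the scheme is contractive as soon as these three numbers are nonpositive
    ([contractive_of_coefs_le0]).  For [B], completing the square in the
    coordinate of [Phi 0] costs [- z] times a square, and the remainder
    [- a y^2 + z tau y w - c w^2], with [a = z^3 / 4 + sigma], is a binary form
    whose sign is decided by its discriminant ([Bmx_neg_semidefinite]).

    In the two special cases, each of [a1], [a2], [a3], [c] and the discriminant
    is zero or a product of powers of [z], [1 - z], [1 + z] and a factor of
    constant sign on [0 < z < 1].  The first case is the upwind-biased scheme on
    four points ([D0 - Delta / 2] is the backward difference, so that
    [sigma D0 Delta + tau Delta^2 = sigma D Delta]) and has [a3 = 0]; the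
    second is the five-point Lax-Wendroff scheme of order four and has
    [a1 = 0]. *)

(** * Expansion of the quadratic forms *)

Lemma quad_formE (R : realType) (n : nat) (M : 'M[R]_n) (v : 'cV[R]_n) :
  quad_form M v = \sum_i \sum_j v j 0 * M j i * v i 0.
Proof.
rewrite /quad_form !mxE; apply: eq_bigr => i _.
by rewrite !mxE mulr_suml; apply: eq_bigr => j _; rewrite !mxE.
Qed.

Lemma TfluxE (R : realType) (z sigma tau : R) (Phi : int -> R) (j : int)
    (h := sigma / 2 + tau) (x := Phi j) (d := Dm Phi (j + 1))
    (u := Delta Phi j) (w := Dm (Delta Phi) (j + 1)) :
  Tflux z sigma tau Phi j
    = - z * x ^+ 2 + (z ^+ 2 * (1 - z) / 2 - sigma) * d ^+ 2
      + (z ^+ 2 * sigma / 2 + z * tau) * u ^+ 2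
      + (z * sigma / 4 + z ^+ 2 * tau / 2 + sigma * tau
         - a1 z sigma tau / 3) * w ^+ 2
      - z * (1 - z) * x * d + 2 * sigma * x * u + 2 * h * x * w
      + 2 * (sigma / 2 - z * sigma - tau) * d * u - 2 * z * h * d * w
      + 2 * (z * (1 + z) / 2 * h - a1 z sigma tau / 3) * u * w.
Proof.
rewrite /Tflux quad_formE !big_ord_recl !big_ord0 !mxE /= -/h -/x -/d -/u -/w.
by field.
Qed.

Lemma StermE (R : realType) (z sigma tau : R) (Phi : int -> R) (j : int)
    (u := Delta Phi (j - 1)) (v := Delta Phi j) (w := Delta Phi (j + 1)) :
  Sterm z sigma tau Phi j
    = a1 z sigma tau / 3 * (u ^+ 2 + v ^+ 2 + w ^+ 2)
      + a2 z sigma tau * ((u - v) ^+ 2 + (v - w) ^+ 2)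
      + a3 sigma tau * (u - 2 * v + w) ^+ 2.
Proof.
rewrite /Sterm quad_formE !big_ord_recl !big_ord0 !mxE /= -/u -/v -/w.
by field.
Qed.

Lemma quad_form_BmxE (R : realType) (z sigma tau : R) (v : 'cV[R]_3)
    (x := v 0 0) (y := v 1 0) (w := v 2%:R 0) :
  quad_form (Bmx z sigma tau) v
    = - z * x ^+ 2 - (z ^+ 3 / 2 + sigma) * y ^+ 2
      + (2 * tau / 3 + sigma * tau + 5 * z * sigma / 12 - z ^+ 2 * tau / 2
         + sigma ^+ 2 / 2 - z ^+ 2 * (1 - z ^+ 2) / 12) * w ^+ 2
      + z ^+ 2 * x * y - 2 * tau * x * w + 2 * z * tau * y * w.
Proof.
rewrite quad_formE !big_ord_recl !big_ord0 !mxE /=.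
have -> : lift ord0 ord0 = 1 :> 'I_3 by apply: val_inj.
have -> : lift ord0 (lift ord0 ord0) = 2%:R :> 'I_3 by apply: val_inj.
rewrite -[ord0]/(0 : 'I_3) -/x -/y -/w.
by field.
Qed.

(** * Contractivity *)

Lemma energy_balance (R : realType) (z sigma tau : R) (Phi : int -> R)
    (j : int) :
  A_op z sigma tau Phi j ^+ 2
    = Phi j ^+ 2 + Tflux z sigma tau Phi j - Tflux z sigma tau Phi (j - 1)
      + Sterm z sigma tau Phi j.
Proof.
rewrite !TfluxE StermE /A_op /a1 /a2 /a3; cbv zeta.
rewrite /D0 /Dm /Delta !(addrK, subrK).
by field.
Qed.

Lemma contractive_of_coefs_le0 (R : realType) (z sigma tau : R) :
  a1 z sigma tau <= 0 -> a2 z sigma tau <= 0 -> a3 sigma tau <= 0 ->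
  contractive z sigma tau.
Proof.
move=> a1_le0 a2_le0 a3_le0 Phi j; split; first exact: energy_balance.
rewrite StermE; cbv zeta.
set u := Delta Phi (j - 1); set v := Delta Phi j; set w := Delta Phi (j + 1).
have h1 : a1 z sigma tau / 3 * (u ^+ 2 + v ^+ 2 + w ^+ 2) <= 0.
  by rewrite mulr_le0_ge0 ?addr_ge0 ?sqr_ge0 //; lra.
have h2 : a2 z sigma tau * ((u - v) ^+ 2 + (v - w) ^+ 2) <= 0.
  by rewrite mulr_le0_ge0 ?addr_ge0 ?sqr_ge0.
have h3 : a3 sigma tau * (u - 2 * v + w) ^+ 2 <= 0.
  by rewrite mulr_le0_ge0 ?sqr_ge0.
lra.
Qed.

(** * Ghost values and the boundary contribution *)

(** Evaluates the shifted indices, so that equal values of the grid function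
    become equal atoms for the arithmetic tactics. *)
Lemma shifts_near0 :
  (((0 - 1)%R = (-1)%R :> int) * ((0 + 1)%R = 1%R :> int)
   * ((1 - 1)%R = 0%R :> int) * ((1 + 1)%R = 2%R :> int)
   * ((-1 - 1)%R = (-2)%R :> int) * ((-1 + 1)%R = 0%R :> int))%type.
Proof. by []. Qed.

(** The first condition involves [Phi 1] alone; given it, the second one reads
    [Delta Phi 1 = - Delta Phi (-1)] and has [Phi 2] with coefficient 1. *)
Lemma second_order_ghosts (R : realType) (Phi : int -> R) :
  extrapolation2 Phi <->
  Phi 1 = 2 * Phi 0 - Phi (-1) /\ Phi 2 = 2 * Phi 0 - Phi (-2).
Proof.
rewrite /extrapolation2 /Delta !shifts_near0.
by split=> -[] e1 e2; split; lra.
Qed.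

Lemma defines_ghost_values_extrapolation2 (R : realType) :
  defines_ghost_values (@extrapolation2 R).
Proof.
move=> Phi.
exists (2 * Phi 0 - Phi (-1), 2 * Phi 0 - Phi (-2)).
split; first by apply/second_order_ghosts.
move=> [g1 g2] /second_order_ghosts [] /=.
by rewrite /with_ghosts /= => -> ->.
Qed.

Lemma boundary_contributionE (R : realType) (z sigma tau : R)
    (Phi : int -> R) :
  extrapolation2 Phi ->
  boundary_contribution (1 / 2) z sigma tau Phi
    = quad_form (Bmx z sigma tau) (Zvec Phi).
Proof.
move=> /second_order_ghosts [Phi1 Phi2].
rewrite /boundary_contribution quad_form_BmxE !TfluxE StermE; cbv zeta.
rewrite /Zvec !mxE /= /a1 /a2 /a3 /Dm /Delta.
rewrite !shifts_near0.
rewrite Phi1 Phi2.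
by field.
Qed.

(** * Negative semi-definiteness of the boundary matrix *)

(** Multiplying by [4 a] turns minus the form into a square plus
    [4 a c - b^2] times a square. *)
Lemma binary_form_le0 (R : realFieldType) (a b c y w : R) :
  0 < a -> b ^+ 2 <= 4 * a * c ->
  - (a * y ^+ 2) + b * y * w - c * w ^+ 2 <= 0.
Proof.
move=> a_gt0 disc.
have eqn : - (a * y ^+ 2) + b * y * w - c * w ^+ 2 =
    - (((2 * a * y - b * w) ^+ 2 + (4 * a * c - b ^+ 2) * w ^+ 2) / (4 * a)).
  by field; rewrite gt_eqF.
rewrite eqn oppr_le0 divr_ge0 ?addr_ge0 ?sqr_ge0 //.
- by rewrite mulr_ge0 ?sqr_ge0 // subr_ge0.
- by rewrite mulr_ge0 // ltW.
Qed.

Lemma Bmx_sym (R : realType) (z sigma tau : R) :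
  (Bmx z sigma tau)^T = Bmx z sigma tau.
Proof.
apply/matrixP=> i j; rewrite !mxE.
by case: i => [[|[|[|i]]] Hi] //; case: j => [[|[|[|j]]] Hj].
Qed.

(** The Schur complement of the top left entry [- z] of [B] is a two by two
    form with diagonal [- (z^3 / 4 + sigma)], [- c] and off-diagonal entry
    [z tau / 2].  The number [c] is a parameter so that each special case can
    supply it in factored form, which is the form in which the discriminant
    can be estimated. *)
Lemma Bmx_neg_semidefinite (R : realType) (z sigma tau c : R) :
  0 < z -> 0 <= sigma ->
  c = - (2 * tau / 3 + sigma * tau + 5 * z * sigma / 12 - z ^+ 2 * tau / 2
         + sigma ^+ 2 / 2 - z ^+ 2 * (1 - z ^+ 2) / 12 + tau ^+ 2 / z) ->
  (z * tau) ^+ 2 <= 4 * (z ^+ 3 / 4 + sigma) * c ->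
  neg_semidefinite (Bmx z sigma tau).
Proof.
move=> z_gt0 sigma_ge0 def_c disc; split=> [|v]; first exact: Bmx_sym.
rewrite quad_form_BmxE; cbv zeta.
set x := v 0 0; set y := v 1 0; set w := v _ 0.
have a_gt0 : 0 < z ^+ 3 / 4 + sigma.
  by rewrite ltr_pwDl // divr_gt0 // exprn_gt0.
have -> : - z * x ^+ 2 - (z ^+ 3 / 2 + sigma) * y ^+ 2
      + (2 * tau / 3 + sigma * tau + 5 * z * sigma / 12 - z ^+ 2 * tau / 2
         + sigma ^+ 2 / 2 - z ^+ 2 * (1 - z ^+ 2) / 12) * w ^+ 2
      + z ^+ 2 * x * y - 2 * tau * x * w + 2 * z * tau * y * w
  = - (z * (x - z / 2 * y + tau / z * w) ^+ 2)
    + (- ((z ^+ 3 / 4 + sigma) * y ^+ 2) + z * tau * y * w - c * w ^+ 2).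
  by rewrite def_c; field; rewrite gt_eqF.
have sq_le0 : - (z * (x - z / 2 * y + tau / z * w) ^+ 2) <= 0.
  by rewrite oppr_le0 mulr_ge0 ?sqr_ge0 // ltW.
have bin_le0 := binary_form_le0 y w a_gt0 disc.
lra.
Qed.

(** * Semi-bounded schemes *)

Lemma semi_bounded_of_signs (R : realType) (z sigma tau : R) :
  a1 z sigma tau <= 0 -> a2 z sigma tau <= 0 -> a3 sigma tau <= 0 ->
  neg_semidefinite (Bmx z sigma tau) ->
  semi_bounded (1 / 2) (@extrapolation2 R) z sigma tau.
Proof.
move=> a1_le0 a2_le0 a3_le0 [_ B_le0]; split.
  exact: contractive_of_coefs_le0.
by move=> Phi /boundary_contributionE ->; apply: B_le0.
Qed.

(** With [k = 1 - z^2], so that [sigma = z k / 6], the Schur complement has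
    [c = z k (7 - 5 z) (1 + z) / 144] and
    [z^3 / 4 + sigma = z (2 + z^2) / 12], and the discriminant condition becomes
    [3 z^2 (1 - z) <= (2 + z^2) (7 - 5 z)]. *)
Lemma semi_bounded_third_order_upwind (R : realType) (z sigma tau : R) :
  0 < z < 1 -> sigma = z * (1 - z ^+ 2) / 6 -> tau = - (sigma / 2) ->
  semi_bounded (1 / 2) (@extrapolation2 R) z sigma tau
  /\ neg_semidefinite (Bmx z sigma tau).
Proof.
move=> /andP[z_gt0 z_lt1] def_sigma def_tau.
have k_gt0 : 0 < 1 - z by lra.
have sigma_ge0 : 0 <= sigma.
  have -> : sigma = z * ((1 - z) * (1 + z)) / 6 by rewrite def_sigma; field.
  by rewrite !(mulr_ge0, divr_ge0) //; lra.
have B_le0 : neg_semidefinite (Bmx z sigma tau).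
  apply: (@Bmx_neg_semidefinite _ _ _ _
            (z * (1 - z ^+ 2) * (7 - 5 * z) * (1 + z) / 144)) => //.
    by rewrite def_tau def_sigma; field; rewrite gt_eqF.
  rewrite -subr_ge0.
  have -> : 4 * (z ^+ 3 / 4 + sigma) *
        (z * (1 - z ^+ 2) * (7 - 5 * z) * (1 + z) / 144) - (z * tau) ^+ 2
      = z ^+ 2 * ((1 - z) * (1 + z) ^+ 2)
        * ((2 + z ^+ 2) * (7 - 5 * z) - 3 * (z ^+ 2 * (1 - z))) / 432.
    by rewrite def_tau def_sigma; field.
  (* The last factor equals 10 (1 - z) + 4 + 2 z^2 + 2 z^2 (1 - z). *)
  have z2_ge0 : 0 <= z ^+ 2 by exact: sqr_ge0.
  have z2k_ge0 : 0 <= z ^+ 2 * (1 - z) by rewrite mulr_ge0 // ltW.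
  by rewrite !(mulr_ge0, divr_ge0, exprn_ge0) //; lra.
split=> //; apply: semi_bounded_of_signs => //.
- have -> : a1 z sigma tau = - (sigma * (2 - z) / 2).
    by rewrite /a1 def_tau def_sigma; field.
  by rewrite oppr_le0 !(mulr_ge0, divr_ge0) //; lra.
- have -> : a2 z sigma tau = - (sigma * (z * (1 - z) * (2 - z)) / 12).
    by rewrite /a2 def_tau def_sigma; field.
  by rewrite oppr_le0 !(mulr_ge0, divr_ge0) //; lra.
- have -> // : a3 sigma tau = 0 by rewrite /a3 def_tau; field.
Qed.

(** Here [tau = - z sigma / 4].  With [k = 1 - z^2], the Schur complement has
    [c = z^2 k (4 - z^2 + 3 z k / 4) / 144], and the discriminant condition
    becomes [3 z^3 k <= (2 + z^2) (16 - 4 z^2 + 3 z k)]. *)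
Lemma semi_bounded_fourth_order (R : realType) (z sigma tau : R) :
  0 < z < 1 -> sigma = z * (1 - z ^+ 2) / 6 ->
  tau = - (z ^+ 2 * (1 - z ^+ 2) / 24) ->
  semi_bounded (1 / 2) (@extrapolation2 R) z sigma tau
  /\ neg_semidefinite (Bmx z sigma tau).
Proof.
move=> /andP[z_gt0 z_lt1] def_sigma def_tau.
have k_gt0 : 0 < 1 - z ^+ 2 by nra.
have sigma_ge0 : 0 <= sigma.
  by rewrite def_sigma divr_ge0 // mulr_ge0 // ltW.
have B_le0 : neg_semidefinite (Bmx z sigma tau).
  apply: (@Bmx_neg_semidefinite _ _ _ _
            (z ^+ 2 * (1 - z ^+ 2)
             * (4 - z ^+ 2 + 3 * z * (1 - z ^+ 2) / 4) / 144)) => //.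
    by rewrite def_tau def_sigma; field; rewrite gt_eqF.
  rewrite -subr_ge0.
  have -> : 4 * (z ^+ 3 / 4 + sigma) *
        (z ^+ 2 * (1 - z ^+ 2)
         * (4 - z ^+ 2 + 3 * z * (1 - z ^+ 2) / 4) / 144) - (z * tau) ^+ 2
      = z ^+ 3 * (1 - z ^+ 2)
        * ((2 + z ^+ 2) * (16 - 4 * z ^+ 2 + 3 * (z * (1 - z ^+ 2)))
           - 3 * (z ^+ 3 * (1 - z ^+ 2))) / 1728.
    by rewrite def_tau def_sigma; field.
  (* With k = 1 - z^2, the last factor equals
     (2 + z^2) (4 k + 12) + 6 z k. *)
  have z2_ge0 : 0 <= z ^+ 2 by exact: sqr_ge0.
  have zk_ge0 : 0 <= z * (1 - z ^+ 2) by rewrite mulr_ge0 // ltW.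
  have z2k_ge0 : 0 <= z ^+ 2 * (1 - z ^+ 2) by rewrite mulr_ge0 // ltW.
  by rewrite !(mulr_ge0, divr_ge0, exprn_ge0) //; lra.
split=> //; apply: semi_bounded_of_signs => //.
- have -> // : a1 z sigma tau = 0 by rewrite /a1 def_tau def_sigma; field.
- have -> : a2 z sigma tau = - (sigma * (z * (3 + (1 - z ^+ 2))) / 24).
    by rewrite /a2 def_tau def_sigma; field.
  by rewrite oppr_le0 !(mulr_ge0, divr_ge0) //; lra.
- have -> : a3 sigma tau = - (sigma ^+ 2 * (3 + (1 - z ^+ 2)) / 16).
    by rewrite /a3 def_tau def_sigma; field.
  by rewrite oppr_le0 !(mulr_ge0, divr_ge0, exprn_ge0) //; lra.
Qed.

Theorem proposition2 (R : realType) :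
  defines_ghost_values (@extrapolation2 R)
  /\ (forall (z sigma tau : R) (Phi : int -> R),
        extrapolation2 Phi ->
        boundary_contribution (1 / 2) z sigma tau Phi
          = quad_form (Bmx z sigma tau) (Zvec Phi))
  /\ (forall z sigma tau : R,
        0 < z < 1 ->
        (sigma = z * (1 - z ^+ 2) / 6 /\ tau = - (sigma / 2))
        \/ (sigma = z * (1 - z ^+ 2) / 6
            /\ tau = - (z ^+ 2 * (1 - z ^+ 2) / 24)) ->
        semi_bounded (1 / 2) (@extrapolation2 R) z sigma tau
        /\ neg_semidefinite (Bmx z sigma tau)).
Proof.
split; first exact: defines_ghost_values_extrapolation2.
split; first exact: boundary_contributionE.
move=> z sigma tau z01 [[def_sigma def_tau]|[def_sigma def_tau]].
- exact: semi_bounded_third_order_upwind.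
- exact: semi_bounded_fourth_order.
Qed.
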